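(* Let $G$ be a finite group and let $\mathcal{C}\subset G$ be a cyclic conjugacy class with $n$ elements. Then, up to normalisation (overall nonzero scaling), all nondegenerate $\mathrm{Ad}$-invariant bilinear forms on $\Omega_0^*$ are given by $$\eta^{a,b}=\delta_{a,b}+\mu,\qquad a,b\in\mathcal{C},$$ for a constant $\mu\ne-1/n$. The associated metric in the Maurer-Cartan framing is $$g=\sum_{a\in\mathcal{C}}e_a\otimes_H e_a+\mu\,\theta\otimes_H\theta .$$
   Context: Cyclic: a conjugacy class $\mathcal{C}$ with $n\ge 2$ elements in a group $G$ is called cyclic if there exists at least one $t\in\mathcal{C}$ such that $\mathrm{Ad}_t$ (where $\mathrm{Ad}_a(b)=aba^{-1}$) is a cyclic permutation of $\mathcal{C}-\{t\}$ (a single cycle on this set) and the map $a\mapsto \mathrm{Ad}_a(t)$ is a permutation of $\mathcal{C}$. $H=\mathbb{C}[G]$ is the algebra of complex functions on $G$, and $(R_af)(g)=f(ga)$. $\Omega_0=\mathbb{C}\mathcal{C}$ is the complex vector space with basis indexed by $\mathcal{C}$. $\Omega^1(H)$ is the free left $H$-module with basis the Maurer-Cartan 1-forms $\{e_a\}_{a\in\mathcal{C}}$ (the framing), with right module structure $e_af=R_a(f)e_a$; $\theta=\sum_{a\in\mathcal{C}}e_a$. A bilinear form $\eta$ on $\Omega_0^*$ is given by its complex coefficients $\eta^{a,b}=\eta(f^a,f^b)$, $a,b\in\mathcal{C}$, in the dual basis $\{f^a\}$. It is nondegenerate if the matrix $(\eta^{a,b})$ is invertible, and $\mathrm{Ad}$-invariant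 if $\eta^{g^{-1}ag,b}=\eta^{a,gbg^{-1}}$ for all $a,b\in\mathcal{C}$, $g\in G$. The associated coframing is $e^{*a}=\sum_{b\in\mathcal{C}}e_b\eta^{b,a}$, and the associated metric is $g=\sum_{a\in\mathcal{C}}e^{*a}\otimes_H e_a\in\Omega^1(H)\otimes_H\Omega^1(H)$. *)

(* Defs.v *)
From HB Require Import structures.
From mathcomp Require Import all_boot all_order all_algebra all_fingroup.
From mathcomp Require Import sesquilinear.
From mathcomp Require Import reals.
From mathcomp Require Import complex.

Set Implicit Arguments.
Unset Strict Implicit.
Unset Printing Implicit Defensive.

Import Order.TTheory GRing.Theory Num.Theory.
Local Open Scope ring_scope.

(* The group is the whole of [gT]; its conjugacy classes are the members of
   [classes [set: gT]]. *)

Definition Ad (gT : finGroupType) (a b : gT) : gT := (a * b * a^-1)%g.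

(* "[Ad t] is a single cycle on [C :\ t]" is the existence of a duplicate-free
   cyclic sequence [s] enumerating [C :\ t] along which [Ad t] maps each entry
   to the next one. *)
Definition cyclic_class (gT : finGroupType) (C : {set gT}) : Prop :=
  [/\ C \in classes [set: gT], (2 <= #|C|)%N &
    exists t : gT,
      [/\ t \in C,
          exists2 s : seq gT, s =i C :\ t & ufcycle (Ad t) s,
          [set Ad a t | a in C] = C &
          {in C &, injective (fun a => Ad a t)}]].

(* The elements of [C] as a finite type, used as index set. *)
Definition cls (gT : finGroupType) (C : {set gT}) : finType :=
  {a : gT | a \in C}.

Definition Omega0 (R : realType) (gT : finGroupType) (C : {set gT})
  : vectType R[i] := {ffun cls C -> R[i]^o}.

Definition Omega0_dual (R : realType) (gT : finGroupType) (C : {set gT})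
  : vectType R[i] := 'Hom(Omega0 R C, R[i]^o).

Definition dual_basis (R : realType) (gT : finGroupType) (C : {set gT})
  (a : cls C) : Omega0_dual R C := linfun (fun v : Omega0 R C => v a : R[i]^o).

Lemma dual_basisE (R : realType) (gT : finGroupType) (C : {set gT})
  (a : cls C) (v : Omega0 R C) : dual_basis R a v = v a.
Proof.
pose f (v : Omega0 R C) : R[i]^o := v a.
have fL : linear f by move=> k x y; rewrite /f !ffunE.
pose L : {linear Omega0 R C -> R[i]^o} :=
  HB.pack f (GRing.isLinear.Build _ _ _ _ f fL).
exact: (lfunE L).
Qed.

Definition coef (R : realType) (gT : finGroupType) (C : {set gT})
  (eta : {biscalar (Omega0_dual R C)}) (a b : cls C) : R[i] :=
  eta (dual_basis R a) (dual_basis R b).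

Definition nondeg_form (R : realType) (gT : finGroupType) (C : {set gT})
  (eta : {biscalar (Omega0_dual R C)}) : Prop :=
  \matrix_(i < #|cls C|, j < #|cls C|) coef eta (enum_val i) (enum_val j)
    \in unitmx.

(* [a'] and [b'] stand for g^-1 a g and g b g^-1, which lie in [C] when [C] is
   a conjugacy class. *)
Definition Ad_invariant (R : realType) (gT : finGroupType) (C : {set gT})
  (eta : {biscalar (Omega0_dual R C)}) : Prop :=
  forall (g : gT) (a b a' b' : cls C),
    val a' = (g^-1 * val a * g)%g -> val b' = (g * val b * g^-1)%g ->
    coef eta a' b = coef eta a b'.

Definition H (R : realType) (gT : finGroupType) : pzRingType :=
  {ffun gT -> R[i]}.

Definition cst (R : realType) (gT : finGroupType) (c : R[i]) : H R gT :=
  [ffun _ : gT => c].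

Definition rtrans (R : realType) (gT : finGroupType) (a : gT) (f : H R gT)
  : H R gT := [ffun g : gT => (f : {ffun gT -> R[i]}) (g * a)%g].

(* Free left K-module with basis I; [co w a] is the coefficient of [w] on the
   basis vector [bas a]. *)
Definition free_mod (K : pzRingType) (I : finType) : lmodType K :=
  {ffun I -> K^o}.

Definition co (K : pzRingType) (I : finType) (w : free_mod K I) (a : I) : K :=
  (w : {ffun I -> K^o}) a.

Definition bas (K : pzRingType) (I : finType) (a : I) : free_mod K I :=
  [ffun b => (b == a)%:R : K^o].

Definition Omega1 (R : realType) (gT : finGroupType) (C : {set gT})
  : lmodType (H R gT) := free_mod (H R gT) (cls C).

Definition e_ (R : realType) (gT : finGroupType) (C : {set gT}) (a : cls C)
  : Omega1 R C := bas (H R gT) a.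

(* Right action, determined by e_a f = R_a(f) e_a. *)
Definition rmul (R : realType) (gT : finGroupType) (C : {set gT})
  (w : Omega1 R C) (f : H R gT) : Omega1 R C :=
  [ffun a : cls C => (co w a * rtrans (val a) f : (H R gT)^o)].

Definition theta (R : realType) (gT : finGroupType) (C : {set gT})
  : Omega1 R C := \sum_(a : cls C) e_ R a.

Definition balanced (R : realType) (gT : finGroupType) (C : {set gT})
  (V : zmodType) (u : Omega1 R C -> Omega1 R C -> V) : Prop :=
  [/\ forall w w' v, u (w + w') v = u w v + u w' v,
      forall w v v', u w (v + v') = u w v + u w v' &
      forall w f v, u (rmul w f) v = u w (f *: v)].

(* [T] with [tens] is the tensor product over H of Omega^1 (as a right module)
   with Omega^1 (as a left module): it is universal among balanced maps, and
   carries the left H-module structure f (w (x) v) = (f w) (x) v. *)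
Definition is_tensor_product (R : realType) (gT : finGroupType) (C : {set gT})
  (T : lmodType (H R gT)) (tens : Omega1 R C -> Omega1 R C -> T) : Prop :=
  [/\ balanced tens,
      forall f w v, tens (f *: w) v = f *: tens w v &
      forall (V : zmodType) (u : Omega1 R C -> Omega1 R C -> V), balanced u ->
        exists2 phi : {additive T -> V},
          forall w v, phi (tens w v) = u w v &
          forall psi : {additive T -> V},
            (forall w v, psi (tens w v) = u w v) -> psi =1 phi].

(* Scalars act through constant functions, here from the right as written in
   e^{*a} = sum_b e_b eta^{b,a}. *)
Definition coframe (R : realType) (gT : finGroupType) (C : {set gT})
  (eta : {biscalar (Omega0_dual R C)}) (a : cls C) : Omega1 R C :=
  \sum_(b : cls C) rmul (e_ R b) (cst gT (coef eta b a)).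

Definition metric (R : realType) (gT : finGroupType) (C : {set gT})
  (T : lmodType (H R gT)) (tens : Omega1 R C -> Omega1 R C -> T)
  (eta : {biscalar (Omega0_dual R C)}) : T :=
  \sum_(a : cls C) tens (coframe eta a) (e_ R a).

Section FreeModTheory.
Variables (K : pzRingType) (I : finType).
Implicit Types (w v : free_mod K I).

Lemma coP w v : co w =1 co v -> w = v.
Proof. by move=> E; apply/ffunP. Qed.

Lemma coD w v a : co (w + v) a = co w a + co v a.
Proof. exact: ffunE. Qed.

Lemma co0 a : co (0 : free_mod K I) a = 0.
Proof. exact: ffunE. Qed.

Lemma coZ f w a : co (f *: w) a = f * co w a.
Proof. exact: ffunE. Qed.

Lemma cobas (a b : I) : co (bas K a) b = (b == a)%:R.
Proof. exact: ffunE. Qed.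

Lemma cosum (J : finType) (F : J -> free_mod K I) a :
  co (\sum_j F j) a = \sum_j co (F j) a.
Proof.
apply: (big_morph (fun w : free_mod K I => co w a)) => [x y|].
  exact: coD.
exact: co0.
Qed.

Lemma codec w : w = \sum_a co w a *: bas K a.
Proof.
apply: coP => b; rewrite cosum (bigD1 b) //= coZ cobas eqxx mulr1 big1 ?addr0 //.
by move=> a /negPf ab; rewrite coZ cobas eq_sym ab mulr0.
Qed.

End FreeModTheory.

Section TensorModel.
Variables (R : realType) (gT : finGroupType) (C : {set gT}).
Local Notation H := (H R gT).
Local Notation Omega1 := (Omega1 R C).

Lemma rtransD a (f h : H) : rtrans a (f + h) = rtrans a f + rtrans a h.
Proof. by apply/ffunP=> g; rewrite !ffunE. Qed.

Lemma rtransM a (f h : H) : rtrans a (f * h) = rtrans a f * rtrans a h.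
Proof. by apply/ffunP=> g; rewrite !ffunE. Qed.

Lemma rtrans_nat a (b : bool) : rtrans a (b%:R : H) = b%:R.
Proof. by apply/ffunP=> g; case: b; rewrite !ffunE. Qed.

(* The free module on the e_a (x) e_b, showing that [is_tensor_product] is
   satisfiable. *)
Definition tensor_model : lmodType H := free_mod H (cls C * cls C)%type.

Definition tens_model (w v : Omega1) : tensor_model :=
  [ffun p : cls C * cls C => (co w p.1 * rtrans (val p.1) (co v p.2) : H^o)].

Lemma co_tens w v p :
  co (tens_model w v) p = co w p.1 * rtrans (val p.1) (co v p.2).
Proof. exact: ffunE. Qed.

Lemma co_rmul (w : Omega1) f a : co (rmul w f) a = co w a * rtrans (val a) f.
Proof. exact: ffunE. Qed.

Lemma rmul_e (a : cls C) (f : H) : rmul (e_ R a) f = rtrans (val a) f *: e_ R a.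
Proof.
apply: (@coP H (cls C)) => b; rewrite co_rmul coZ cobas.
by have [->|_] := eqVneq b a; rewrite ?mulr0 ?mul0r ?mulr1 ?mul1r.
Qed.

Lemma tens_bas (f : H) a b :
  tens_model (f *: e_ R a) (e_ R b) = f *: bas H (a, b).
Proof.
apply: coP => -[p q]; rewrite co_tens !coZ !cobas /= rtrans_nat xpair_eqE -mulrA.
by rewrite -natrM mulnb.
Qed.

Lemma tens_model_is_tensor_product : is_tensor_product tens_model.
Proof.
split.
- split.
  + by move=> w w' v; apply: coP => p; rewrite coD !co_tens coD mulrDl.
  + by move=> w v v'; apply: coP => p; rewrite coD !co_tens coD rtransD mulrDr.
  + by move=> w f v; apply: coP => p; rewrite !co_tens co_rmul coZ rtransM mulrA.
- by move=> f w v; apply: coP => p; rewrite coZ !co_tens coZ mulrA.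
move=> V u [uD1 uD2 uB].
have u0l v : u 0 v = 0.
  by apply: (@addrI _ (u 0 v)); rewrite -uD1 !addr0.
have u0r w : u w 0 = 0.
  by apply: (@addrI _ (u w 0)); rewrite -uD2 !addr0.
have usl (I : finType) (F : I -> Omega1) v :
    u (\sum_i F i) v = \sum_i u (F i) v.
  by apply: (big_morph (fun w => u w v)) => // x y; apply: uD1.
have usr (I : finType) (F : I -> Omega1) w :
    u w (\sum_i F i) = \sum_i u w (F i).
  by apply: (big_morph (u w)) => // x y; apply: uD2.
have decO (w : Omega1) : w = \sum_a co w a *: e_ R a by exact: codec.
have sumP (F : cls C * cls C -> V) : \sum_p F p = \sum_a \sum_b F (a, b).
  by rewrite pair_bigA; apply: eq_bigr => -[].
pose ph (z : tensor_model) : V := \sum_p u (co z p *: e_ R p.1) (e_ R p.2).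
have phD : zmod_morphism ph.
  have phA : {morph ph : x y / x + y}.
    move=> x y; rewrite -big_split; apply: eq_bigr => p _ /=.
    by rewrite coD scalerDl uD1.
  move=> x y; apply: (@addIr _ (ph y)).
  by rewrite -phA subrK addrNK.
pose phM := GRing.isZmodMorphism.Build _ _ ph phD.
pose phi : {additive tensor_model -> V} := HB.pack ph phM.
exists phi.
- move=> w v; transitivity (ph (tens_model w v)); first by [].
  rewrite /ph sumP.
  have -> : u w v = \sum_a \sum_b u (co w a *: e_ R a) (co v b *: e_ R b).
    by rewrite {1}(decO w) usl; apply: eq_bigr => a _; rewrite {1}(decO v) usr.
  apply: eq_bigr => a _; apply: eq_bigr => b _.
  rewrite co_tens /= -uB; congr (u _ _); apply: (@coP H (cls C)) => c.
  by rewrite co_rmul !coZ cobas; have [->|_] := eqVneq c a;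
    rewrite ?mulr0 ?mul0r ?mulr1.
- move=> psi psiE z; rewrite [in LHS](codec z) raddf_sum /= /ph.
  by apply: eq_bigr => -[a b] _; rewrite -tens_bas psiE.
Qed.

End TensorModel.

(* Main.v *)
(* For [t] as in the definition of a cyclic class, the powers of [t] fix [t] and
   are transitive on [C :\ t]; hence [G] acts doubly transitively on [C], and an
   Ad-invariant matrix takes one value on the diagonal and one off it.  A matrix
   [x I + y J], with [J] the all-ones matrix of size [n >= 2], is invertible iff
   [x] and [x + n y] are nonzero. *)

From HB Require Import structures.
Require Import Defs.
From mathcomp Require Import all_boot all_order all_algebra all_fingroup.
From mathcomp Require Import sesquilinear reals complex ring.

Set Implicit Arguments.
Unset Strict Implicit.
Unset Printing Implicit Defensive.

Import Order.TTheory GRing.Theory Num.Theory.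
Local Open Scope ring_scope.

(** * Invertibility of x I + y J *)

Lemma unitmx_scalar_add_const (F : fieldType) (m : nat) (x y : F) :
  (1 < m)%N ->
  ((x%:M + const_mx y : 'M[F]_m) \in unitmx) =
    (x != 0) && (x + m%:R * y != 0).
Proof.
case: m => [|[|m]] // _; pose n := m.+2; rewrite -/n.
have JJ (u v : F) : (const_mx u : 'M_n) *m (const_mx v : 'M_n) =
    const_mx (n%:R * (u * v)).
  apply/matrixP=> i j; rewrite !mxE (eq_bigr (fun=> u * v)); last first.
    by move=> k _; rewrite !mxE.
  by rewrite sumr_const card_ord mulr_natl.
have xJ (c u : F) : c%:M *m (const_mx u : 'M_n) = const_mx (c * u) :> 'M_n.
  by rewrite mul_scalar_mx; apply/matrixP=> i j; rewrite !mxE.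
apply/idP/andP=> [Mu | [x0 xy0]].
  split; apply/eqP=> z.
    (* When x = 0 all rows coincide, and the size is at least 2, so the determinant vanishes. *)
    move: Mu; rewrite z raddf0 add0r unitmxE.
    rewrite (@determinant_alternate _ _ _ ord0 (lift ord0 ord0)) ?unitr0 //.
    by move=> j; rewrite !mxE.
  (* J is an eigenmatrix: (x I + y J) J = (x + n y) J. If this is 0, cancelling the unit forces J =
     0. *)
  have: (x%:M + const_mx y) *m (const_mx 1 : 'M_n) = 0 :> 'M_n.
    rewrite mulmxDl xJ JJ; apply/matrixP=> i j.
    by rewrite !mxE !mulr1 z.
  move/(congr1 (mulmx (invmx (x%:M + const_mx y)))); rewrite mulKmx // mulmx0.
  move/matrixP/(_ ord0 ord0); rewrite !mxE => /eqP.
  by rewrite oner_eq0.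
(* Solves x w + y / x + n y w = 0, the J-coefficient of (x I + y J)(x^-1 I + w J). *)
pose w := - (y / (x * (x + n%:R * y))).
suff /mulmx1_unit[] :
    (x%:M + const_mx y) *m (x^-1%:M + const_mx w) = 1%:M :> 'M_n by [].
rewrite mulmxDl !mulmxDr xJ JJ -scalar_mxM mulfV // scalar_mxC xJ.
rewrite -[RHS]addr0 -addrA; congr (_ + _).
apply/matrixP=> i j; rewrite !mxE /w.
by field; rewrite xy0.
Qed.

(** * Double transitivity of conjugation on a cyclic class *)

Lemma iter_Ad (gT : finGroupType) (t b : gT) (k : nat) :
  iter k (Ad t) b = (b ^ (t^-1 ^+ k))%g.
Proof.
elim: k => [|k IHk]; first by rewrite conjg1.
by rewrite iterS IHk expgSr conjgM /Ad [RHS]conjgE invgK -mulgA.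
Qed.

(** Conjugating inside the class reduces both pairs to pairs with first entry [t]; the second
    entries then lie in [C :\ t], where a power of [t^-1] joins them. *)
Lemma cyclic_class_2transitive (gT : finGroupType) (C : {set gT})
  (a b a' b' : gT) :
  cyclic_class C -> a \in C -> b \in C -> a' \in C -> b' \in C ->
  a != b -> a' != b' -> exists g, a' = (a ^ g)%g /\ b' = (b ^ g)%g.
Proof.
case=> /imsetP[x _ Cx] _ [t [tC [s sE /andP[cs _]] _ _]].
have conjt c : c \in C -> exists g, c = (t ^ g)%g.
  move: tC; rewrite Cx => /imsetP[u _ ->] /imsetP[v _ ->].
  by exists (u^-1 * v)%g; rewrite conjgM conjgK.
have CJ c g : ((c ^ g)%g \in C) = (c \in C).
  by rewrite Cx memJ_norm // (subsetP (class_norm _ _)) ?inE.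
(* The stabiliser of [t] is transitive on [C :\ t]: the number of steps from [c] to [c'] along the
   cycle is the exponent of [t^-1]. *)
have tok c c' : c \in C -> c' \in C -> c != t -> c' != t ->
    exists2 g, (t ^ g)%g = t & c' = (c ^ g)%g.
  move=> cC c'C ct c't.
  have cs' : c \in s by rewrite sE !inE ct.
  have : fconnect (Ad t) c c' by rewrite (fconnect_cycle cs cs') sE !inE c't.
  move=> /iter_findex <-; exists (t^-1 ^+ findex (Ad t) c c')%g.
    by rewrite -iter_Ad; elim: (findex _ _ _) => //= k ->; rewrite /Ad mulgK.
  by rewrite iter_Ad.
move=> aC bC a'C b'C ab a'b'.
have [[g Eg] [g' Eg']] := (conjt a aC, conjt a' a'C).
have [||||h th bh] := tok (b ^ g^-1)%g (b' ^ g'^-1)%g.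
- by rewrite CJ.
- by rewrite CJ.
- by rewrite (can2_eq (conjgKV g) (conjgK g)) -Eg eq_sym.
- by rewrite (can2_eq (conjgKV g') (conjgK g')) -Eg' eq_sym.
(* Conjugation by [g^-1] takes [a] to [t], [h] fixes [t] and matches the second entries, [g'] takes
   [t] to [a']. *)
exists (g^-1 * h * g')%g; split.
  by rewrite {1}Eg' Eg !conjgM conjgK th.
by rewrite !conjgM -bh conjgKV.
Qed.

(** * Coefficients of invariant forms and their coframings *)

Section Forms.
Variables (R : realType) (gT : finGroupType) (C : {set gT}).
Implicit Types (eta : {biscalar (Omega0_dual R C)}) (x y mu : R[i]).

(** Putting g^-1 b g for b in the definition of invariance turns its mixed form into invariance
    under simultaneous conjugation. *)
Lemma Ad_invariantJ eta (g : gT) (a b a' b' : cls C) :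
  Ad_invariant eta -> val a' = (val a ^ g)%g -> val b' = (val b ^ g)%g ->
  coef eta a' b' = coef eta a b.
Proof.
move=> inv Ea Eb; apply: (inv g); first by rewrite Ea conjgE mulgA.
by rewrite Eb conjgE !mulgA mulgV mul1g mulgK.
Qed.

Lemma card_cls : #|cls C| = #|C|.
Proof. by rewrite card_sig; apply: eq_card. Qed.

Lemma Ad_invariant_coef eta :
  cyclic_class C -> Ad_invariant eta ->
  exists x y, forall a b, coef eta a b = x * (a == b)%:R + y.
Proof.
move=> hC inv; have [_ C2 _] := hC.
have [t [t' [tC t'C tt']]] := card_gt1P C2.
have valC (c : cls C) : val c \in C by case: c.
have same (a b a' b' : cls C) : a != b -> a' != b' ->
    exists g, val a' = (val a ^ g)%g /\ val b' = (val b ^ g)%g.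
  by move=> ab a'b'; apply: cyclic_class_2transitive => //.
pose c0 : cls C := Sub t tC; pose c1 : cls C := Sub t' t'C.
have c01 : c0 != c1 by [].
(* y is the off-diagonal value, x the excess of the diagonal value over it. *)
exists (coef eta c0 c0 - coef eta c0 c1), (coef eta c0 c1) => a b.
have [<-|ab] := eqVneq a b; last first.
  have [g [Ea Eb]] := same _ _ _ _ c01 ab.
  by rewrite mulr0 add0r (Ad_invariantJ inv Ea Eb).
rewrite mulr1 subrK.
(* Any [c] other than [a] completes a pair, so that double transitivity yields a [g] moving [c0] to
   [a]. *)
have [c ac] : exists c, a != c.
  by have [->|] := eqVneq a c0; [exists c1 | exists c0].
have [g [Ea _]] := same _ _ _ _ c01 ac.
exact: (Ad_invariantJ inv Ea Ea).
Qed.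

Lemma nondeg_formE eta x y : (1 < #|C|)%N ->
  (forall a b, coef eta a b = x * (a == b)%:R + y) ->
  nondeg_form eta <-> x != 0 /\ x + #|C|%:R * y != 0.
Proof.
move=> C2 E; rewrite /nondeg_form.
have -> : \matrix_(i, j) coef eta (enum_val i) (enum_val j) =
    x%:M + const_mx y :> 'M_(#|cls C|).
  apply/matrixP=> i j; rewrite !mxE E (inj_eq enum_val_inj).
  by case: eqP; rewrite ?mulr1 ?mulr0.
by rewrite unitmx_scalar_add_const card_cls //; split=> /andP.
Qed.

(** Invariance reduces to the equivalence of g^-1 a g = b and a = g b g^-1. *)
Lemma coef_Ad_invariant eta x y :
  (forall a b, coef eta a b = x * (a == b)%:R + y) -> Ad_invariant eta.
Proof.
move=> E g a b a' b' Ea Eb; rewrite !E; congr (_ * _%:R + _).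
rewrite -!val_eqE Ea Eb; congr nat_of_bool; apply/eqP/eqP=> [<-|->].
  by rewrite !mulgA mulgV mul1g mulgK.
by rewrite !mulgA mulVg mul1g mulgKV.
Qed.

(** Supplies a genuine bilinear form for each admissible mu, by evaluating functionals on the basis
    [v] to which [dual_basis] is dual. *)
Lemma coef_surj (m : cls C -> cls C -> R[i]) :
  exists eta, forall a b, coef eta a b = m a b.
Proof.
pose v (a : cls C) : Omega0 R C := [ffun b => (b == a)%:R : R[i]^o].
pose f (p q : Omega0_dual R C) : R[i] :=
  \sum_a \sum_b p (v a) * m a b * q (v b).
have fB : bilinear_for *%R *%R f.
  split=> p k q r; rewrite /f /= mulr_sumr -big_split; apply: eq_bigr => a _ /=;
    rewrite mulr_sumr -big_split; apply: eq_bigr => b _ /=;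
    rewrite add_lfunE scale_lfunE /GRing.scale /=; ring.
pose eta : {biscalar (Omega0_dual R C)} :=
  HB.pack f (bilinear_isBilinear.Build _ _ _ _ _ _ f fB).
exists eta => a b; rewrite /coef /= /f.
have vE c d : dual_basis R c (v d) = (c == d)%:R by rewrite dual_basisE ffunE.
rewrite (bigD1 a) //= (bigD1 b) //= !vE !eqxx mulr1 mul1r.
rewrite !big1 ?addr0 // => [c ca|c cb].
  by rewrite big1 // => d _; rewrite vE eq_sym (negPf ca) !mul0r.
by rewrite vE eq_sym (negPf cb) mulr0.
Qed.

Lemma coframeE eta mu (a : cls C) :
  (forall a b, coef eta a b = (a == b)%:R + mu) ->
  coframe eta a = e_ R a + cst gT mu *: theta R C.
Proof.
move=> E; rewrite /coframe /theta scaler_sumr.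
(* Right translation fixes constant functions, so the scalar passes from the right of e_b to the
   left. *)
have cE b : rmul (e_ R b) (cst gT (coef eta b a)) =
    (b == a)%:R *: e_ R b + cst gT mu *: e_ R b.
  rewrite rmul_e E -scalerDl; congr (_ *: _).
  by apply/ffunP=> h; rewrite !ffunE; case: (b == a); rewrite !ffunE.
rewrite (eq_bigr _ (fun b _ => cE b)) big_split /=; congr (_ + _).
rewrite (bigD1 a) //= eqxx scale1r big1 ?addr0 // => b /negPf->.
by rewrite scale0r.
Qed.

End Forms.

(** * Classification and metric *)

Lemma balanced_sumr (R : realType) (gT : finGroupType) (C : {set gT})
  (V : zmodType) (u : Omega1 R C -> Omega1 R C -> V) (I : finType)
  (F : I -> Omega1 R C) (w : Omega1 R C) :
  balanced u -> u w (\sum_i F i) = \sum_i u w (F i).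
Proof.
case=> _ uD _; apply: (big_morph (u w)); first exact: uD.
by apply: (@addrI _ (u w 0)); rewrite -uD !addr0.
Qed.

Theorem theorem3p6 (R : realType) (gT : finGroupType) (C : {set gT})
  (n : nat) (Cn : #|C| = n) (hC : cyclic_class C)
  (T : lmodType (H R gT)) (tens : Omega1 R C -> Omega1 R C -> T)
  (hT : is_tensor_product tens) :
  [/\ forall eta : {biscalar (Omega0_dual R C)},
        nondeg_form eta /\ Ad_invariant eta <->
        exists lambda mu : R[i],
          [/\ lambda != 0, mu != - (n%:R)^-1 &
              forall a b : cls C,
                coef eta a b = lambda * ((a == b)%:R + mu)],
      forall mu : R[i], mu != - (n%:R)^-1 ->
        exists eta : {biscalar (Omega0_dual R C)},
          [/\ nondeg_form eta, Ad_invariant eta &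
              forall a b : cls C, coef eta a b = (a == b)%:R + mu] &
      forall (mu : R[i]) (eta : {biscalar (Omega0_dual R C)}),
        mu != - (n%:R)^-1 ->
        (forall a b : cls C, coef eta a b = (a == b)%:R + mu) ->
        metric tens eta =
          \sum_(a : cls C) tens (e_ R a) (e_ R a)
          + cst gT mu *: tens (theta R C) (theta R C)].
Proof.
have [_ C2 _] := hC; rewrite -Cn in C2 *.
have n0 : (#|C|%:R : R[i]) != 0 by rewrite pnatr_eq0 -lt0n ltnW.
(* With y = x mu, the factor x + n y equals x n (mu + 1/n), which is where the excluded value -1/n
   comes from. *)
have mu_neq (x mu : R[i]) : x != 0 ->
    (mu != - #|C|%:R^-1) = (x + #|C|%:R * (x * mu) != 0).
  move=> x0; congr (~~ _).
  have -> : x + #|C|%:R * (x * mu) = x * #|C|%:R * (mu + #|C|%:R^-1) by field.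
  by rewrite !mulf_eq0 (negPf x0) (negPf n0) addr_eq0.
split.
- move=> eta; split=> [[nd inv] | [x [mu [x0 mu0 E]]]].
    have [x [y E]] := Ad_invariant_coef hC inv.
    have [x0 xy0] := (nondeg_formE C2 E).1 nd.
    exists x, (y / x); split=> [||a b] //.
      by rewrite (mu_neq x) // [x * _]mulrC divfK.
    by rewrite E; field.
  have E' a b : coef eta a b = x * (a == b)%:R + x * mu by rewrite E mulrDr.
  split; last exact: coef_Ad_invariant E'.
  by apply/(nondeg_formE C2 E'); rewrite -mu_neq.
- move=> mu mu0; have [eta E] := coef_surj (fun a b : cls C => (a == b)%:R + mu).
  have E' a b : coef eta a b = 1 * (a == b)%:R + mu by rewrite E mul1r.
  exists eta; split=> //; last exact: coef_Ad_invariant E'.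
  apply/(nondeg_formE C2 E'); split; first exact: oner_neq0.
  by move: mu0; rewrite (mu_neq 1) ?oner_neq0 // mul1r.
- move=> mu eta _ E; have [tB tZ _] := hT; have [tD _ _] := tB.
  (* Expanding only the right-hand theta makes both sides sums over a, with common term (e_a + mu
     theta) tensor e_a. *)
  rewrite [theta in X in _ = _ + _ *: tens _ X]/theta balanced_sumr //.
  rewrite scaler_sumr -big_split; apply: eq_bigr => a _ /=.
  by rewrite (coframeE _ E) tD tZ.
Qed.
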